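(* Let $D$ be an integral domain, $K$ the quotient field of $D$ and let $X$ be an indeterminate over $K$. Then $D$ is condensed if and only if $D+XK[X]$ is condensed.
   Context: $D+XK[X]=\{f\in K[X] : f(0)\in D\}$. For an integral domain $R$ and nonzero ideals $I,J$ of $R$, the product $IJ$ is condensed if $IJ=\{ij : i\in I,\ j\in J\}$; $R$ is condensed if $IJ$ is condensed for every pair of nonzero ideals $I,J$ of $R$. *)

(* Defs.v *)
From HB Require Import structures.
From mathcomp Require Import all_boot all_algebra.
From mathcomp Require Import boolp classical_sets.

Set Implicit Arguments.
Unset Strict Implicit.
Unset Printing Implicit Defensive.

Import GRing.Theory.

Local Open Scope classical_set_scope.
Local Open Scope ring_scope.

(* [idealr_closed] of ring_quotient only covers proper ideals, whereas the unit
   ideal must be allowed here. *)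
Definition is_ideal (R : comNzRingType) (I : set R) : Prop :=
  [/\ I 0, forall x y, I x -> I y -> I (x + y) & forall a x, I x -> I (a * x)].

Definition nonzero_ideal (R : comNzRingType) (I : set R) : Prop :=
  is_ideal I /\ exists2 x, I x & x != 0.

Definition ideal_mul (R : comNzRingType) (I J : set R) : set R :=
  [set x | exists2 s : seq (R * R),
     forall p, p \in s -> I p.1 /\ J p.2 & x = \sum_(p <- s) p.1 * p.2].

Definition condensed_mul (R : comNzRingType) (I J : set R) : Prop :=
  ideal_mul I J = [set i * j | i in I & j in J].

Definition condensed (R : idomainType) : Prop :=
  forall I J : set R, nonzero_ideal I -> nonzero_ideal J -> condensed_mul I J.

Section DXKX.
Variable D : idomainType.

(* D + X K[X], where K = {fraction D} and membership of the constant coefficient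
   in D means membership in the image of [tofrac]. This being undecidable in
   general, units and inverses are chosen classically below. *)
Definition dxkx_pred : {pred {poly {fraction D}}} :=
  fun f => f.[0] \in range (@tofrac D).

Lemma dxkx_subring_closed : subring_closed dxkx_pred.
Proof.
have E f : (f \in dxkx_pred) = (f.[0] \in range (@tofrac D)) by [].
split=> [|f g|f g]; rewrite !E.
- by rewrite hornerC; apply/mem_set; exists 1; rewrite ?tofrac1.
- move=> /set_mem[a _ fa] /set_mem[b _ gb]; apply/mem_set.
  by exists (a - b); rewrite // hornerD hornerN -fa -gb; apply: rmorphB.
- move=> /set_mem[a _ fa] /set_mem[b _ gb]; apply/mem_set.
  by exists (a * b); rewrite // hornerM -fa -gb; apply: rmorphM.
Qed.

HB.instance Definition _ :=
  GRing.isSubringClosed.Build _ dxkx_pred dxkx_subring_closed.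

Record dxkx := DXKX { dxkx_val :> {poly {fraction D}} ; _ : dxkx_val \in dxkx_pred }.

HB.instance Definition _ := [isSub for dxkx_val].
HB.instance Definition _ := [Choice of dxkx by <:].
HB.instance Definition _ := [SubChoice_isSubComNzRing of dxkx by <:].

Definition dxkx_unit : {pred dxkx} := fun f => `[< exists g, g * f = 1 >].

Definition dxkx_inv (f : dxkx) : dxkx := xget f [set g | g * f = 1].

Lemma dxkx_mulVr : {in dxkx_unit, left_inverse 1 dxkx_inv *%R}.
Proof. by move=> f /asboolP[g gf1]; apply: (@xgetPex _ f [set g | g * f = 1]); exists g. Qed.

Lemma dxkx_unitP (f g : dxkx) : g * f = 1 -> dxkx_unit f.
Proof. by move=> gf1; apply/asboolP; exists g. Qed.

Lemma dxkx_inv_out : {in [predC dxkx_unit], dxkx_inv =1 id}.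
Proof.
move=> f; rewrite inE => /asboolPn nf.
by apply: xgetPN => g gf1; apply: nf; exists g.
Qed.

HB.instance Definition _ := GRing.ComNzRing_hasMulInverse.Build dxkx
  dxkx_mulVr dxkx_unitP dxkx_inv_out.

Lemma dxkx_idomain : GRing.integral_domain_axiom dxkx.
Proof.
move=> f g fg0; have := congr1 val fg0; rewrite rmorphM rmorph0 => /eqP.
by rewrite mulf_eq0 => /orP[] /eqP h; apply/orP; [left|right];
   apply/eqP/val_inj; rewrite h rmorph0.
Qed.

HB.instance Definition _ := GRing.ComUnitRing_isIntegral.Build dxkx dxkx_idomain.

End DXKX.

(* Main.v *)
(* Every nonzero ideal of R = D + XK[X] has the form f(W + XK[X]), with f a
   generator of its extension to K[X] and W a nonzero D-submodule of K. So
   (if D is condensed) multiplication of such ideals reduces to that of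
   D-submodules of K, and, each sum of products being finite, to that of ideals
   of D by clearing denominators. Conversely an ideal I of D is the set of
   constant coefficients of the ideal I + XK[X] of R. *)
Require Import Defs.
From mathcomp Require Import all_boot all_algebra.
From mathcomp Require Import generic_quotient boolp classical_sets.
From mathcomp Require Import ring.

Set Implicit Arguments.
Unset Strict Implicit.
Unset Printing Implicit Defensive.

Import GRing.Theory.

Local Open Scope classical_set_scope.
Local Open Scope ring_scope.

(** * Products of ideals as finite sums, and principal ideals of $F[X]$ *)

Lemma condensed_mulP (R : comNzRingType) (I J : set R) :
  (forall s : seq (R * R), (forall p, p \in s -> I p.1 /\ J p.2) ->
     exists i j, [/\ I i, J j & \sum_(p <- s) p.1 * p.2 = i * j]) ->
  condensed_mul I J.
Proof.
move=> IJ; apply/seteqP; split=> x /=.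
  by move=> [s /IJ[i [j [Ii Jj ->]]] ->]; exists i => //; exists j.
move=> [i Ii [j Jj <-]]; exists [:: (i, j)]; last by rewrite big_seq1.
by move=> p; rewrite inE => /eqP ->.
Qed.

Lemma condensed_mul_sum (R : comNzRingType) (I J : set R) (s : seq (R * R)) :
  condensed_mul I J -> (forall p, p \in s -> I p.1 /\ J p.2) ->
  exists i j, [/\ I i, J j & \sum_(p <- s) p.1 * p.2 = i * j].
Proof.
move=> IJ sIJ; have : ideal_mul I J (\sum_(p <- s) p.1 * p.2) by exists s.
by rewrite IJ => -[i Ii [j Jj <-]]; exists i, j.
Qed.

Lemma ideal_sum (R : comNzRingType) (I : set R) (T : eqType) (s : seq T)
    (F : T -> R) :
  is_ideal I -> (forall t, t \in s -> I (F t)) -> I (\sum_(t <- s) F t).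
Proof.
by case=> I0 ID _ sI; rewrite big_seq; apply: big_ind => // t; apply: sI.
Qed.

(** Division with remainder by a nonzero element of minimal size: the remainder stays in [I] and is
    smaller, so it vanishes. *)
Lemma poly_ideal_principal (F : fieldType) (I : set {poly F}) :
  nonzero_ideal I -> exists2 f, f != 0 & I = [set q * f | q in [set: {poly F}]].
Proof.
move=> [[I0 ID IM] [p0 Ip0 p0N0]].
pose P n := `[< exists p, [/\ I p, p != 0 & size p = n] >].
have exP : exists n, P n by exists (size p0); apply/asboolP; exists p0.
case: (ex_minnP exP) => n /asboolP[f [If fN0 <-]] min_f.
exists f => //; apply/seteqP; split=> [p Ip|_ [q _ <-]]; last exact: IM.
exists (p %/ f) => //; apply/esym/eqP; rewrite -subr_eq0.
have -> : p - p %/ f * f = p %% f by rewrite {1}(divp_eq p f) addrC addKr.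
apply: contraT => rN0; have := ltn_modpN0 p fN0; rewrite ltnNge min_f //.
apply/asboolP; exists (p %% f); split=> //.
have -> : p %% f = p + (- (p %/ f)) * f by rewrite {2}(divp_eq p f); ring.
by apply: ID => //; apply: IM.
Qed.

(** * Submodules of the quotient field and clearing of denominators *)

Section Fractions.
Variable D : idomainType.
Local Notation K := {fraction D}.

Lemma frac_numden (x : K) : exists n d : D, d != 0 /\ tofrac d * x = tofrac n.
Proof.
elim/quotW: x => x; exists x.1, x.2; split; first exact: denom_ratioP.
unlock tofrac; rewrite -[LHS]FracField.pi_mul /=; apply/eqmodP.
rewrite /= FracField.equivfE /FracField.mulf.
by rewrite !numden_Ratio ?mul1r ?mulr1 ?oner_neq0 ?denom_ratioP // mulrC.
Qed.

Lemma common_denominator (s : seq (K * K)) :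
  exists2 d : D, d != 0 & forall p, p \in s ->
    exists a b, tofrac d * p.1 = tofrac a /\ tofrac d * p.2 = tofrac b.
Proof.
elim: s => [|p s [d dN0 IH]]; first by exists 1; rewrite ?oner_neq0.
have [n1 [d1 [d1N0 E1]]] := frac_numden p.1.
have [n2 [d2 [d2N0 E2]]] := frac_numden p.2.
exists (d * d1 * d2); first by rewrite !mulf_neq0.
move=> q; rewrite inE => /predU1P[->|/IH[a [b [Ea Eb]]]].
  by exists (d * d2 * n1), (d * d1 * n2); rewrite !rmorphM /= -E1 -E2; split; ring.
by exists (d1 * d2 * a), (d1 * d2 * b); rewrite !rmorphM /= -Ea -Eb; split; ring.
Qed.

Definition is_submodule (W : set K) : Prop :=
  [/\ W 0, forall x y, W x -> W y -> W (x + y) &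
      forall a x, W x -> W (tofrac a * x)].

(** For [d != 0] this is $dW \cap D$, an ideal of [D]. *)
Definition scaled_numerators (W : set K) (d : D) : set D :=
  [set a | W (tofrac a / tofrac d)].

Lemma scaled_numerators_ideal (W : set K) (d : D) : d != 0 ->
  is_submodule W -> (exists2 w, W w & w != 0) ->
  nonzero_ideal (scaled_numerators W d).
Proof.
move=> dN0 [W0 WD WM] [w Ww wN0]; rewrite /scaled_numerators.
split; first split => /=.
- by rewrite rmorph0 mul0r.
- by move=> x y Wx Wy; rewrite rmorphD mulrDl; apply: WD.
- by move=> a x Wx; rewrite rmorphM -mulrA; apply: WM.
have [n [m [mN0 E]]] := frac_numden w.
(* With $w = n/m$, the element $nd/d = n = mw$ lies in [W]. *)
exists (n * d) => /=.
  by rewrite tofracM mulfK ?tofrac_eq0 // -E; apply: WM.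
by rewrite mulf_neq0 // -(tofrac_eq0 n) -E mulf_neq0 // tofrac_eq0.
Qed.

(** A common denominator [d] of all entries turns the sum into $d^{-2}$ times a sum of products from
    $dW \cap D$ and $dV \cap D$, which factors in [D]. The first factor is made nonzero so that
    polynomials over [K] can later be divided by it. *)
Lemma submodule_sum_mul (W V : set K) (s : seq (K * K)) :
  condensed D -> is_submodule W -> is_submodule V ->
  (exists2 w, W w & w != 0) -> (exists2 v, V v & v != 0) ->
  (forall p, p \in s -> W p.1 /\ V p.2) ->
  exists w v, [/\ W w, V v, w != 0 & \sum_(p <- s) p.1 * p.2 = w * v].
Proof.
move=> cD sW sV nzW nzV sWV.
have [d dN0 ds] := common_denominator s.
have dFN0 : tofrac d != 0 by rewrite tofrac_eq0.
have [t tWV tsum] : exists2 t : seq (D * D),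
    forall p, p \in t -> scaled_numerators W d p.1 /\ scaled_numerators V d p.2
  & \sum_(p <- s) p.1 * p.2
    = tofrac (\sum_(p <- t) p.1 * p.2) / (tofrac d * tofrac d).
  elim: s sWV ds => [|p s IH] sWV ds.
    by exists [::] => //; rewrite !big_nil rmorph0 mul0r.
  have [|q qs|t tWV tsum] := IH.
  - by move=> q qs; apply: sWV; rewrite inE qs orbT.
  - by apply: ds; rewrite inE qs orbT.
  have [a [b [Ea Eb]]] := ds p (mem_head _ _).
  have [Wp Vp] := sWV p (mem_head _ _).
  have pa : tofrac a / tofrac d = p.1 by rewrite -Ea mulrC mulKf.
  have pb : tofrac b / tofrac d = p.2 by rewrite -Eb mulrC mulKf.
  exists ((a, b) :: t).
    move=> q; rewrite inE => /predU1P[->|/tWV //].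
    by rewrite /scaled_numerators /= pa pb.
  by rewrite !big_cons tsum rmorphD rmorphM /= -pa -pb; field.
have [a [b [Wa Vb ab]]] := condensed_mul_sum
  (cD _ _ (scaled_numerators_ideal dN0 sW nzW)
          (scaled_numerators_ideal dN0 sV nzV)) tWV.
have sE : \sum_(p <- s) p.1 * p.2 = (tofrac a / tofrac d) * (tofrac b / tofrac d).
  by rewrite tsum ab rmorphM /=; field.
(* If the first factor found is zero, so is the sum, and any nonzero [w] in [W] times 0 serves
   instead. *)
have [a0|aN0] := eqVneq (tofrac a / tofrac d) 0.
  case: nzW sV => w Ww wN0 [V0 _ _]; exists w, 0; split=> //.
  by rewrite sE a0 mul0r mulr0.
by exists (tofrac a / tofrac d), (tofrac b / tofrac d).
Qed.

End Fractions.

(** * Ideals of $D+XK[X]$ and the two implications *)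

Section DXKXIdeals.
Variable D : idomainType.
Local Notation K := {fraction D}.
Local Notation R := (dxkx D).

Lemma dxkx_valD (f g : R) : val (f + g) = val f + val g.
Proof. exact: rmorphD. Qed.

Lemma dxkx_valM (f g : R) : val (f * g) = val f * val g.
Proof. exact: rmorphM. Qed.

Lemma dxkx_coef0 (f : R) : exists a : D, (val f).[0] = tofrac a.
Proof.
case: f => f /= fD; have /set_mem[a _ <-] : f.[0] \in range (@tofrac D) := fD.
by exists a.
Qed.

Lemma dxkx_lift (p : {poly K}) (a : D) :
  p.[0] = tofrac a -> exists f : R, val f = p.
Proof.
move=> pa; have pD : p \in @dxkx_pred D by apply/mem_set; exists a.
by exists (DXKX pD).
Qed.

Lemma poly_decomp0 (F : fieldType) (p : {poly F}) :
  exists q, p = p.[0]%:P + 'X * q.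
Proof.
have /factor_theorem[q E] : root (p - p.[0]%:P) 0.
  by rewrite /root hornerD hornerN hornerC subrr.
exists q; rewrite mulrC -['X]subr0 -[in RHS](polyC0 F) -E; ring.
Qed.

(** Let [f] generate the extension [U] of [I] to $K[X]$. Since $XK[X]$ lies in $D+XK[X]$, $XU$ lies
    in [I]; hence whether $qf$ is in [I] depends only on $q(0)$, and [W] collects the admissible
    values. *)
Lemma dxkx_ideal_structure (I : set R) : nonzero_ideal I ->
  exists (f : {poly K}) (W : set K),
    [/\ is_submodule W, exists2 w, W w & w != 0 &
        val @` I = [set a * f | a in [set a | W a.[0]]]].
Proof.
move=> [[I0 ID IM] [i0 Ii0 i0N0]].
pose P : set {poly K} := val @` I.
have PD p q : P p -> P q -> P (p + q).
  by move=> [i Ii <-] [j Ij <-]; exists (i + j); [apply: ID | rewrite dxkx_valD].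
have PM p q (a : D) : p.[0] = tofrac a -> P q -> P (p * q).
  move=> /dxkx_lift[f <-] [i Ii <-].
  by exists (f * i); [apply: IM | rewrite dxkx_valM].
have P0 : P 0 by exists 0; rewrite ?rmorph0.
(* The extension of I to K[X], as the intersection of the ideals above it. *)
pose U : set {poly K} := [set p | forall S, is_ideal S -> P `<=` S -> S p].
have PU : P `<=` U by move=> p Pp S _; apply.
have idU : is_ideal U.
  split=> [S [] //|p q Up Uq S idS PS|a p Up S idS PS]; case: (idS) => _ SD SM.
    by apply: SD; [apply: Up | apply: Uq].
  by apply: SM; apply: Up.
have XU p q : U p -> P ('X * q * p).
  move=> Up; rewrite -mulrA [q * p]mulrC mulrA; move: q.
  (* This set is an ideal of $K[X]$. It contains [P] because $Xq$ has constant coefficient 0, so it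
     contains [U]. *)
  apply: (Up [set p | forall q, P ('X * p * q)]).
    split=> /= [q|x y Px Py q|a x Px q].
    - by rewrite mulr0 mul0r.
    - by rewrite mulrDr mulrDl; apply: PD.
    - by rewrite (_ : _ * q = 'X * x * (a * q)); [apply: Px | ring].
  move=> x Px q /=; rewrite (_ : _ * q = 'X * q * x); last by ring.
  by apply: (PM _ _ 0) => //; rewrite hornerM hornerX mul0r rmorph0.
have [f fN0 UE] : exists2 f, f != 0 & U = [set q * f | q in [set: {poly K}]].
  apply: poly_ideal_principal; split=> //; exists (val i0).
    by apply: PU; exists i0.
  by rewrite -(rmorph0 (val : R -> {poly K})) (inj_eq val_inj).
have Uf : U f by rewrite UE; exists 1; rewrite ?mul1r.
pose W : set K := [set c | P (c%:P * f)].
exists f, W; split.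
- split=> [|x y Wx Wy|a x Wx]; rewrite /W /=.
  + by rewrite mul0r.
  + by rewrite polyCD mulrDl; apply: PD.
  + by rewrite polyCM -mulrA; apply: (PM _ _ a) => //; rewrite hornerC.
- (* otherwise X f would already divide the whole of I, hence f *)
  apply: contrapT => nW.
  have [||q fq] := Uf [set p | exists q, p = 'X * q * f].
  + split=> /= [|_ _ [q ->] [r ->]|a _ [q ->]].
    * by exists 0; rewrite mulr0 mul0r.
    * by exists (q + r); ring.
    * by exists (a * q); ring.
  + move=> p Pp; have : U p by apply: PU.
    (* With $q = q(0) + Xr$, subtracting $Xrf$, which is in [P], leaves $q(0)f$ in [P]; as [W] has
       no nonzero element, $q(0) = 0$. *)
    rewrite UE => -[q _ qf]; have [r qE] := poly_decomp0 q.
    exists r => /=; rewrite -qf {1}qE.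
    have [-> |cN0] := eqVneq q.[0] 0; first by rewrite add0r.
    case: nW; exists q.[0] => //; rewrite /W /=.
    rewrite (_ : _ * f = p + 'X * (- r) * f); first by apply: PD => //; apply: XU.
    by rewrite -qf {2}qE; ring.
  (* Cancelling [f] from $f = Xqf$ gives $1 - Xq = 0$, absurd at 0. *)
  + have : (1 - 'X * q) * f == 0 by rewrite mulrBl mul1r -fq subrr.
    rewrite mulf_eq0 (negPf fN0) orbF => /eqP/(congr1 (horner^~ 0)).
    rewrite hornerD hornerN hornerM hornerX mul0r subr0 hornerC horner0.
    by move/eqP; rewrite oner_eq0.
(* In both directions $qf$ and $q(0)f$ differ by a multiple of $Xf$, which is in [P]. *)
- apply/seteqP; split=> p.
    move=> Pp; have : U p by apply: PU.
    rewrite UE => -[q _ qf]; exists q => //; rewrite /W /=.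
    have [r qE] := poly_decomp0 q.
    rewrite (_ : _ * f = p + 'X * (- r) * f); first by apply: PD => //; apply: XU.
    by rewrite -qf {2}qE; ring.
  move=> [q Wq <-]; have [r ->] := poly_decomp0 q.
  by rewrite mulrDl; apply: PD => //; apply: XU.
Qed.

(** The sum equals $hfg$, where $h(0)$ is a sum of products from [W] and [V], hence $h(0) = wv$ with
    $w \neq 0$. Writing $h = wv + Xr = w(v + Xw^{-1}r)$ splits it as $wf$ times $(v +
    Xw^{-1}r)g$. *)
Lemma condensed_dxkx : condensed D -> condensed R.
Proof.
move=> cD I J /dxkx_ideal_structure[f [W [sW nzW IE]]].
move=> /dxkx_ideal_structure[g [V [sV nzV JE]]].
apply: condensed_mulP => s sIJ.
have [t tWV tsum] : exists2 t : seq ({poly K} * {poly K}),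
    forall p, p \in t -> W p.1.[0] /\ V p.2.[0]
  & val (\sum_(p <- s) p.1 * p.2) = (\sum_(p <- t) p.1 * p.2) * (f * g).
  elim: s sIJ => [|p s IH] sIJ.
    by exists [::] => //; rewrite !big_nil rmorph0 mul0r.
  have [|t tWV tsum] := IH.
    by move=> q qs; apply: sIJ; rewrite inE qs orbT.
  have [Ip Jp] := sIJ p (mem_head _ _).
  have : (val @` I) (val p.1) by exists p.1.
  rewrite IE => -[a Wa Ea].
  have : (val @` J) (val p.2) by exists p.2.
  rewrite JE => -[b Vb Eb].
  exists ((a, b) :: t); first by move=> q; rewrite inE => /predU1P[->|/tWV].
  by rewrite !big_cons dxkx_valD dxkx_valM tsum -Ea -Eb /=; ring.
set h := \sum_(p <- t) p.1 * p.2 in tsum.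
have [|w [v [Ww Vv wN0 hE]]] :=
    @submodule_sum_mul D W V [seq (p.1.[0], p.2.[0]) | p <- t] cD sW sV nzW nzV.
  by move=> _ /mapP[p /tWV pWV ->].
have h0 : h.[0] = w * v.
  by rewrite -hE big_map /h horner_sum; apply: eq_bigr => p _; exact: hornerM.
have [r hr] := poly_decomp0 h.
have : (val @` I) (w%:P * f) by rewrite IE; exists w%:P => //=; rewrite hornerC.
move=> [i Ii iE].
(* Membership in [J] only asks that the constant coefficient [v] of the cofactor be in [V], so all
   of [r] can be absorbed here. *)
have : (val @` J) ((v%:P + 'X * (w^-1%:P * r)) * g).
  rewrite JE; exists (v%:P + 'X * (w^-1%:P * r)) => //=.
  by rewrite hornerD hornerC hornerM hornerX mul0r addr0.
move=> [j Jj jE].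
exists i, j; split=> //; apply: val_inj.
rewrite dxkx_valM tsum iE jE hr h0 polyCM.
have ww : w%:P * w^-1%:P = 1 :> {poly K} by rewrite -polyCM mulfV.
rewrite -[X in _ + X]mul1r -ww; ring.
Qed.

(** This is $I + XK[X]$. *)
Definition coef0_preimage (I : set D) : set R :=
  [set f | exists2 a, I a & (val f).[0] = tofrac a].

Lemma coef0_preimage_ideal (I : set D) :
  nonzero_ideal I -> nonzero_ideal (coef0_preimage I).
Proof.
move=> [[I0 ID IM] [a Ia aN0]]; split; first split.
- by exists 0; rewrite // !rmorph0 horner0.
- move=> f g [b Ib fb] [c Ic gc]; exists (b + c); first exact: ID.
  by rewrite dxkx_valD tofracD hornerD fb gc.
- move=> f g [b Ib gb]; have [c fc] := dxkx_coef0 f.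
  by exists (c * b); [apply: IM | rewrite dxkx_valM tofracM hornerM fc gb].
have fa : (tofrac a)%:P.[0] = tofrac a by rewrite hornerC.
have [f fE] := dxkx_lift fa.
exists f; first by exists a; rewrite ?fE.
apply: contraNneq aN0 => f0; move: fa.
by rewrite -fE f0 rmorph0 horner0 => /esym/eqP; rewrite tofrac_eq0.
Qed.

(** Entries of the sum are lifted to constant polynomials, the lifted sum is factored in $D+XK[X]$,
    and evaluation at 0, which is multiplicative, brings the factorization back to [D]. *)
Lemma condensed_of_dxkx : condensed R -> condensed D.
Proof.
move=> cR I J nI nJ; apply: condensed_mulP => s sIJ.
have [t tIJ tsum] : exists2 t : seq (R * R),
    forall p, p \in t -> coef0_preimage I p.1 /\ coef0_preimage J p.2
  & (val (\sum_(p <- t) p.1 * p.2)).[0] = tofrac (\sum_(p <- s) p.1 * p.2).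
  elim: s sIJ => [|p s IH] sIJ.
    by exists [::] => //; rewrite !big_nil !rmorph0 horner0.
  have [|t tIJ tsum] := IH.
    by move=> q qs; apply: sIJ; rewrite inE qs orbT.
  have [Ip Jp] := sIJ p (mem_head _ _).
  have [f fE] := dxkx_lift (hornerC (tofrac p.1) 0).
  have [g gE] := dxkx_lift (hornerC (tofrac p.2) 0).
  exists ((f, g) :: t).
    move=> q; rewrite inE => /predU1P[->|/tIJ //].
    by split; [exists p.1 | exists p.2]; rewrite // ?fE ?gE hornerC.
  rewrite !big_cons dxkx_valD dxkx_valM hornerD tsum hornerM.
  by rewrite fE gE !hornerC tofracD tofracM.
have [f [g [[a Ia fa] [b Jb gb] fg]]] := condensed_mul_sum
  (cR _ _ (coef0_preimage_ideal nI) (coef0_preimage_ideal nJ)) tIJ.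
exists a, b; split=> //; apply/eqP; rewrite -tofrac_eq -tsum fg.
by rewrite dxkx_valM tofracM hornerM fa gb.
Qed.

End DXKXIdeals.

Theorem theorem2p2 (D : idomainType) : condensed D <-> condensed (dxkx D).
Proof. by split; [apply: condensed_dxkx | apply: condensed_of_dxkx]. Qed.
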